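(* Let $X$ be a Polish space with metric $d$ and let $\Phi:\mathbb{R}\times\Omega\times X\to X$ be a measurable random dynamical system over the metric dynamical system $(\Omega,\mathcal{F},P,(\theta_t)_{t\in\mathbb{R}})$ satisfying $$d(\Phi(t,\omega)x,\Phi(t,\omega)y)\le C\,d(x,y)\qquad\text{for all }t\in\mathbb{R},\ \omega\in\Omega,\ x,y\in X,$$ for some constant $C$. Let $H(0,\cdot):\Omega\to X$ be an $\mathcal{F}$-measurable map such that for any $\varepsilon>0$ there exists a number $l(\varepsilon)$ defining a relatively dense set $\{\tau_k\}\subset\mathbb{R}$ such that for almost all $\omega\in\Omega$ and all $k$, $$d\bigl(H(0,\omega),\,\Phi(\tau_k,\theta_{-\tau_k}\omega)H(0,\theta_{-\tau_k}\omega)\bigr)<\varepsilon.$$ Then the map $H:\mathbb{R}\times\Omega\to X$ given by $$H(t,\omega):=\Phi(t,\omega)H(0,\omega)$$ is a random almost periodic solution for the random dynamical system $\Phi$.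
   Context: $(\Omega,\mathcal{F},P)$ is a probability space and $(\theta_t)_{t\in\mathbb{R}}$ is a measure-preserving measurable flow on it: $\theta_0=\mathrm{Id}$, $\theta_{t+s}=\theta_t\circ\theta_s$, $(\omega,t)\mapsto\theta_t\omega$ is measurable, and each $\theta_t$ preserves $P$. Together these form a metric dynamical system. A measurable random dynamical system on $(X,\mathcal{B}(X))$ over $\theta$ is a $(\mathcal{B}(\mathbb{R})\otimes\mathcal{F}\otimes\mathcal{B}(X),\mathcal{B}(X))$-measurable map $\Phi:\mathbb{R}\times\Omega\times X\to X$ such that, writing $\Phi(t,\omega)=\Phi(t,\omega,\cdot)$, one has $\Phi(0,\omega)=\mathrm{id}_X$ and $\Phi(t+s,\omega)=\Phi(t,\theta_s\omega)\circ\Phi(s,\omega)$ for all $s,t\in\mathbb{R}$, $\omega\in\Omega$. A set $E\subset\mathbb{R}$ is relatively dense if there is $l>0$ such that every interval $[a,a+l]$, $a\in\mathbb{R}$, contains at least one point of $E$; a number $l(\varepsilon)$ ''defines'' a relatively dense set $\{\tau_k\}$ if this holds with $l=l(\varepsilon)$. The notation $\{\tau_k\}$ denotes a countable set of numbers. A random almost periodic solution of $\Phi$ is an $\mathcal{F}$-measurable map $H:\mathbb{R}\times\Omega\to X$ (i.e. $\omega\mapsto H(t,\omega)$ is $\mathcal{F}$-measurable for each $t$) such that for any $\varepsilon>0$ there is a number $l(\varepsilon)$ defining a relatively dense set of numbers $\{\tau_k\}$ such that for almost all $\omega\in\Omega$, $$\Phi(t,\theta_s\omega)H(s,\omega)=H(t+s,\omega),\qquad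 d(H(s+\tau_k,\omega),H(s,\theta_{\tau_k}\omega))<\varepsilon,\qquad\forall t,s\in\mathbb{R},\ \forall k.$$ *)

(* Defs.v *)
From HB Require Import structures.
From mathcomp Require Import all_boot all_order all_algebra.
From mathcomp Require Import all_classical all_reals all_analysis.

Set Implicit Arguments.
Unset Strict Implicit.
Unset Printing Implicit Defensive.

Import Order.TTheory GRing.Theory Num.Theory.

Local Open Scope classical_set_scope.
Local Open Scope ring_scope.

HB.mixin Record isSeparable M & Topological M := {
  separable : exists2 D : set M, countable D & dense D
}.

(* Points of [polishMetricType R] carry a distinguished complete metric
   [mdist]. The library's completeness and Borel sets require an inhabited
   type, which loses nothing for spaces that receive a map from a probability
   space. *)
#[short(type="polishMetricType")]
HB.structure Definition PolishMetric (K : numDomainType) :=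
  { M of Metric K M & Complete M & isSeparable M }.

Definition borel (X : ptopologicalType) := g_sigma_algebraType (@open X).

Section random_dynamics.
Context {d : measure_display} {R : realType} {Omega : measurableType d}.

Record metric_dynamical_system (P : probability Omega R)
    (theta : R -> Omega -> Omega) : Prop := {
  flow0 : forall w, theta 0 w = w ;
  flowD : forall t s w, theta (t + s) w = theta t (theta s w) ;
  measurable_flow : measurable_fun [set: Omega * measurableTypeR R]
    (fun p : Omega * measurableTypeR R => theta p.2 p.1) ;
  flow_preserving : forall t (A : set Omega),
    measurable A -> pushforward P (theta t) A = P A
}.

Record measurable_rds (X : polishMetricType R) (theta : R -> Omega -> Omega)
    (Phi : R -> Omega -> X -> X) : Prop := {
  measurable_cocycle :
    measurable_fun [set: measurableTypeR R * Omega * borel X]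
      (fun p : measurableTypeR R * Omega * borel X =>
        Phi p.1.1 p.1.2 p.2 : borel X) ;
  cocycle0 : forall w x, Phi 0 w x = x ;
  cocycleD : forall t s w x, Phi (t + s) w x = Phi t (theta s w) (Phi s w x)
}.

Definition defines_relatively_dense (l : R) (E : set R) :=
  0 < l /\ forall a, E `&` `[a, a + l] !=set0.

Record random_almost_periodic_solution (P : probability Omega R)
    (X : polishMetricType R) (theta : R -> Omega -> Omega)
    (Phi : R -> Omega -> X -> X) (H : R -> Omega -> X) : Prop := {
  measurable_solution : forall t,
    measurable_fun [set: Omega] (H t : Omega -> borel X) ;
  almost_periodic_solution : forall e, 0 < e ->
    exists (l : R) (tau : set R),
      [/\ countable tau, defines_relatively_dense l tau &
          \forall w \ae P,
            (forall t s, Phi t (theta s w) (H s w) = H (t + s) w) /\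
            (forall s k, tau k ->
              mdist (H (s + k) w) (H s (theta k w)) < e)]
}.

End random_dynamics.

(* Main.v *)
Require Import Defs.
From HB Require Import structures.
From mathcomp Require Import all_boot all_order all_algebra.
From mathcomp Require Import all_classical all_reals all_analysis.

Import Order.TTheory GRing.Theory Num.Theory.

Local Open Scope classical_set_scope.
Local Open Scope ring_scope.

(** The invariance [Phi t (theta s w) (H s w) = H (t + s) w] is the cocycle
    property at the point [H0 w]; the content is the almost periodicity, where
    [H t w] is [Phi t w (H0 w)]. By the cocycle property both points
    [H (s + k) w] and [H s (theta k w)] are images under the same map
    [Phi s (theta k w)], namely of [Phi k w (H0 w)] and of [H0 (theta k w)].
    That map is [C]-Lipschitz with [C] independent of [s], so it suffices to
    compare the two preimages. Their distance is the one in the hypothesis on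
    [H0], taken at the point [theta k w] instead of [w], because
    [theta (- k)] undoes [theta k].

    The hypothesis holds only off a null set [N], so it may be used at
    [theta k w] only when [w] avoids the preimage of [N] under [theta k].
    The flow preserves [P], so this preimage is null
    ([ae_measure_preserving]), and there are only countably many almost
    periods [k], so the union of the preimages is still null
    ([ae_forall_countable]). *)

(** An injection of [D] into the natural numbers reduces this to a sequence of
    almost sure properties, the [n]-th one speaking of the at most one index
    sent to [n]. *)
Lemma ae_forall_countable (d : measure_display) (T : measurableType d)
    (R : realType) (mu : {measure set T -> \bar R}) (I : Type) (D : set I)
    (Q : I -> T -> Prop) :
  countable D ->
  (forall i, D i -> \forall x \ae mu, Q i x) ->
  \forall x \ae mu, forall i, D i -> Q i x.
Proof.
move=> /countable_injP[g ginj] DQ.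
have : \forall x \ae mu, forall n i, D i -> g i = n -> Q i x.
  apply/ae_foralln => n.
  have [[i [Di gin]]|nDn] := pselect (exists i, D i /\ g i = n).
    apply: filterS (DQ i Di) => x Qix j Dj gjn.
    by rewrite (ginj j i) ?inE // gjn gin.
  by apply: filterE => x i Di gin; case: nDn; exists i.
by apply: filterS => x Qx i Di; exact: Qx Di erefl.
Qed.

(** The preimage under [f] of a measurable null cover of the exceptional set is
    again a measurable null cover: measurable because [f] is, null because [f]
    preserves [mu]. *)
Lemma ae_measure_preserving (d : measure_display) (T : measurableType d)
    (R : realType) (mu : {measure set T -> \bar R}) (f : T -> T)
    (Q : T -> Prop) :
  measurable_fun [set: T] f ->
  (forall A : set T, measurable A -> mu (f @^-1` A) = mu A) ->
  (\forall x \ae mu, Q x) -> \forall x \ae mu, Q (f x).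
Proof.
move=> mf fmu [N [mN N0 QN]].
exists (f @^-1` N); split; first by rewrite -[_ @^-1` _]setTI; exact: mf.
  by rewrite fmu.
by move=> x nQ; exact: QN.
Qed.

Theorem theorem4p5 (d : measure_display) (R : realType)
    (Omega : measurableType d) (P : probability Omega R)
    (theta : R -> Omega -> Omega) (X : polishMetricType R)
    (Phi : R -> Omega -> X -> X) (C : R) (H0 : Omega -> X) :
  metric_dynamical_system P theta ->
  measurable_rds theta Phi ->
  (forall t w x y, mdist (Phi t w x) (Phi t w y) <= C * mdist x y) ->
  measurable_fun [set: Omega] (H0 : Omega -> borel X) ->
  (forall e : R, 0 < e ->
    exists (l : R) (tau : set R),
      [/\ countable tau, defines_relatively_dense l tau &
          \forall w \ae P, forall k, tau k ->
            mdist (H0 w) (Phi k (theta (- k) w) (H0 (theta (- k) w))) < e]) ->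
  random_almost_periodic_solution P theta Phi (fun t w => Phi t w (H0 w)).
Proof.
move=> [th0 thD mth thP] [mPhi _ PhiD] PhiC mH0 H0tau; split.
  move=> t.
  have mtH0 : measurable_fun [set: Omega]
      (fun w => ((t, w), H0 w) : measurableTypeR R * Omega * borel X).
    by apply: measurable_fun_pair => //; exact: measurable_fun_pair.
  exact: measurableT_comp mPhi mtH0.
move=> e e0.
(* When [X] is a single point the Lipschitz bound allows any [C], so [e] is
   divided by [`|C| + 1], which is positive in all cases. *)
have C1 : 0 < `|C| + 1 by rewrite ltr_wpDl.
have [l [tau [ctau dtau H0ae]]] := H0tau _ (divr_gt0 e0 C1).
exists l, tau; split=> //.
have mthk k : measurable_fun [set: Omega] (theta k).
  exact: (measurable_fun_pair1 k mth).
have : \forall w \ae P, forall k, tau k ->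
    mdist (H0 (theta k w)) (Phi k w (H0 w)) < e / (`|C| + 1).
  apply: ae_forall_countable => // k tk.
  have := ae_measure_preserving _ _ _ P _ _ (mthk k) (thP k) H0ae.
  apply: filterS => w /(_ k tk).
  by rewrite -thD addNr th0.
apply: filterS => w Hw; split=> [t s|s k tk]; first by rewrite PhiD.
rewrite PhiD; apply: le_lt_trans (PhiC _ _ _ _) _.
apply: (@le_lt_trans _ _
    ((`|C| + 1) * mdist (Phi k w (H0 w)) (H0 (theta k w)))).
  apply: ler_wpM2r; first exact: mdist_ge0.
  by rewrite (le_trans (ler_norm C)) // lerDl.
by rewrite mulrC -ltr_pdivlMr // metric_sym; exact: Hw.
Qed.
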